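(* For $k\in\mathbb{Z}$, $\dim \mathrm{BDer}_{k}(\mathfrak{m}_2)=1$ if $k\geq 0$, and $\dim \mathrm{BDer}_{k}(\mathfrak{m}_2)=0$ if $k\leq -1$. In particular, for $k\geq 0$, $\mathrm{BDer}_{k}(\mathfrak{m}_2)$ is spanned by $\sum_{i\geq 2}e^{1,i}_{k+i+1}+\sum_{i\geq 3}e^{2,i}_{k+i+2}$, i.e. by the skew-symmetric bilinear map $f$ with $f(e_1,e_i)=e_{k+i+1}$ for all $i\geq 2$, $f(e_2,e_i)=e_{k+i+2}$ for all $i\geq 3$, and $f(e_i,e_j)=0$ for all $i,j\geq 3$.
   Context: The ground field $\mathbb{F}$ is algebraically closed of characteristic zero. $\mathbb{N}=\{1,2,3,\dots\}$. $\mathfrak{m}_2$ is the $\mathbb{N}$-graded Lie algebra over $\mathbb{F}$ with basis $\{e_i\mid i\geq 1\}$, $e_i$ homogeneous of degree $i$, whose only non-trivial brackets (up to skew-symmetry) are $[e_1,e_i]=e_{i+1}$ for all $i\geq 2$ and $[e_2,e_j]=e_{j+2}$ for all $j\geq 3$. Its degree-$i$ component is $(\mathfrak{m}_2)_i=\mathbb{F}e_i$ for $i\ge 1$, and $(\mathfrak{m}_2)_i=0$ for $i\le 0$. A derivation of a Lie algebra $\mathfrak{g}$ is a linear map $D:\mathfrak{g}\to\mathfrak{g}$ with $D([x,y])=[D(x),y]+[x,D(y)]$ for all $x,y$. A biderivation of $\mathfrak{g}$ is a skew-symmetric ($f(x,y)=-f(y,x)$) bilinear map $f:\mathfrak{g}\times\mathfrak{g}\to\mathfrak{g}$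 such that for every $x\in\mathfrak{g}$ both maps $y\mapsto f(x,y)$ and $y\mapsto f(y,x)$ are derivations of $\mathfrak{g}$; $\mathrm{BDer}(\mathfrak{g})$ is the space of biderivations. For $\mathfrak{g}=\bigoplus_{i\ge1}\mathfrak{g}_i$ graded, $\mathrm{BDer}_k(\mathfrak{g})=\{f\in\mathrm{BDer}(\mathfrak{g})\mid f(\mathfrak{g}_i,\mathfrak{g}_j)\subseteq\mathfrak{g}_{k+i+j}\text{ for all } i,j\in\mathbb{N}\}$. For $i<j$, $e^{i,j}_{k}$ denotes the skew-symmetric bilinear map sending $(e_i,e_j)$ to $e_k$ (hence $(e_j,e_i)$ to $-e_k$) and every other pair of basis vectors to $0$; infinite sums of such maps are understood by evaluation on pairs of basis vectors. *)

(* Defs.v *)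
From HB Require Import structures.
From mathcomp Require Import all_boot all_order all_algebra.
From mathcomp Require Import boolp classical_sets functions.

Set Implicit Arguments.
Unset Strict Implicit.
Unset Printing Implicit Defensive.
Import GRing.Theory.
Local Open Scope ring_scope.
Local Open Scope classical_set_scope.

Definition spanned (F : fieldType) (V : lmodType F) (n : nat) (b : 'I_n -> V) :
    set V :=
  [set v | exists c : 'I_n -> F, v = \sum_(i < n) c i *: b i].

Definition lin_indep (F : fieldType) (V : lmodType F) (n : nat)
    (b : 'I_n -> V) : Prop :=
  forall c : 'I_n -> F, \sum_(i < n) c i *: b i = 0 -> forall i, c i = 0.

(* [vector.v] only handles subspaces of finite-dimensional spaces; here the
   ambient space is the lmodType of all functions g -> g -> g. *)
Definition has_dim (F : fieldType) (V : lmodType F) (S : set V) (n : nat) :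
    Prop :=
  exists b : 'I_n -> V, lin_indep b /\ S = spanned b.

Definition line (F : fieldType) (V : lmodType F) (v : V) : set V :=
  spanned (fun _ : 'I_1 => v).

HB.mixin Record isLie (F : fieldType) L of GRing.Lmodule F L := {
  lie : L -> L -> L;
  lie_linearl : forall y : L, linear (lie ^~ y);
  lie_linearr : forall x : L, linear (lie x);
  liexx : forall x : L, lie x x = 0;
  jacobi : forall x y z : L,
    lie x (lie y z) + lie y (lie z x) + lie z (lie x y) = 0
}.

#[short(type="lieAlgType")]
HB.structure Definition LieAlgebra (F : fieldType) :=
  { L of isLie F L & GRing.Lmodule F L }.

Section Biderivations.
Variables (F : fieldType) (L : lieAlgType F).

Definition derivation (D : L -> L) : Prop :=
  linear D /\ forall x y, D (lie x y) = lie (D x) y + lie x (D y).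

Definition skew_bilinear (f : L -> L -> L) : Prop :=
  [/\ forall y, linear (f ^~ y), forall x, linear (f x)
    & forall x y, f x y = - f y x].

Definition BDer : set (L -> L -> L) :=
  [set f | skew_bilinear f /\
           forall x, derivation (f x) /\ derivation (f ^~ x)].

(* [gr i] is the homogeneous component of degree [i]. *)
Definition BDer_deg (gr : int -> set L) (k : int) : set (L -> L -> L) :=
  [set f | BDer f /\
           forall i j : nat, (1 <= i)%N -> (1 <= j)%N ->
           forall x y, gr i%:Z x -> gr j%:Z y -> gr (k + i%:Z + j%:Z) (f x y)].

End Biderivations.

(* The underlying vector space is that of polynomials, e_i being 'X^(i - 1);
   the product of polynomials plays no role. *)
Definition m2 (F : fieldType) : Type := {poly F}.

HB.instance Definition _ (F : fieldType) := GRing.Lmodule.copy (m2 F) {poly F}.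

(* Indices start at 1; [m2e F 0] is the zero vector. *)
Definition m2e (F : fieldType) (i : nat) : m2 F :=
  if i is j.+1 then ('X^j : {poly F}) else 0.

Section BasisExtension.
Variables (F : fieldType) (V : lmodType F).

Definition lin_ext (b : nat -> V) (x : m2 F) : V :=
  \sum_(i < size (x : {poly F})) (x : {poly F})`_i *: b i.+1.

Definition bilin_ext (b : nat -> nat -> V) (x y : m2 F) : V :=
  lin_ext (fun i => lin_ext (b i) y) x.

Definition skew_table (h : nat -> nat -> V) (i j : nat) : V :=
  if (i < j)%N then h i j else if (j < i)%N then - h j i else 0.

Definition skew_ext (h : nat -> nat -> V) : m2 F -> m2 F -> V :=
  bilin_ext (skew_table h).

Lemma lin_ext_linear (b : nat -> V) : linear (lin_ext b).
Proof.
have E n (x : {poly F}) : (size x <= n)%N ->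
    lin_ext b x = \sum_(i < n) x`_i *: b i.+1.
  move=> le; rewrite /lin_ext (big_ord_widen _ (fun i => x`_i *: b i.+1) le).
  rewrite big_mkcond; apply: eq_bigr => i _; case: ltnP => // h.
  by rewrite nth_default // scale0r.
move=> a x y.
set n := maxn (size (x : {poly F}))
  (maxn (size (y : {poly F})) (size (a *: x + y : {poly F}))).
rewrite !(E n) ?leq_max ?leqnn ?orbT // scaler_sumr -big_split /=.
by apply: eq_bigr => i _; rewrite coefD coefZ scalerDl scalerA.
Qed.

Lemma lin_ext_e (b : nat -> V) (i : nat) :
  (1 <= i)%N -> lin_ext b (m2e F i) = b i.
Proof.
case: i => // i _; rewrite /lin_ext /m2e size_polyXn big_ord_recr /=.
rewrite big1 ?add0r ?coefXn ?eqxx ?scale1r // => j _.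
by rewrite coefXn ltn_eqF // scale0r.
Qed.

Lemma bilin_ext_linearr (b : nat -> nat -> V) x : linear (bilin_ext b x).
Proof.
move=> a y z; rewrite /bilin_ext {1 3 5}/lin_ext scaler_sumr -big_split /=.
apply: eq_bigr => i _; rewrite lin_ext_linear scalerDr !scalerA.
by rewrite [_ * a]mulrC.
Qed.

Lemma bilin_ext_linearl (b : nat -> nat -> V) y : linear (bilin_ext b ^~ y).
Proof. by move=> a x z; rewrite /bilin_ext lin_ext_linear. Qed.

Lemma skew_ext_e (h : nat -> nat -> V) (i j : nat) : (1 <= i)%N -> (1 <= j)%N ->
  skew_ext h (m2e F i) (m2e F j) = skew_table h i j.
Proof. by move=> hi hj; rewrite /skew_ext /bilin_ext !lin_ext_e. Qed.

Lemma linear_ext_e (f g : m2 F -> V) : linear f -> linear g ->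
  (forall i, (1 <= i)%N -> f (m2e F i) = g (m2e F i)) -> f =1 g.
Proof.
have E (h : m2 F -> V) : linear h ->
    forall x, h x = lin_ext (fun i => h (m2e F i)) x.
  move=> hl x.
  have h0 : h 0 = 0.
    by have := hl (-1) 0 0; rewrite !scaleN1r !addNr.
  have hD : {morph h : u v / u + v} by move=> u v; have := hl 1 u v;
    rewrite !scale1r.
  rewrite -[x in LHS](coefK (x : {poly F})) poly_def (big_morph h hD h0).
  apply: eq_bigr => i _.
  by have := hl (x : {poly F})`_i 'X^i 0; rewrite h0 !addr0.
move=> hf hg fg x; rewrite (E _ hf) (E _ hg); apply: eq_bigr => i _.
by rewrite fg.
Qed.

Lemma skew_table_skew (h : nat -> nat -> V) i j :
  skew_table h i j = - skew_table h j i.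
Proof. by rewrite /skew_table; case: ltngtP; rewrite ?opprK ?oppr0. Qed.

Lemma skew_ext_skew (h : nat -> nat -> V) x y :
  skew_ext h x y = - skew_ext h y x.
Proof.
have lN (f : m2 F -> V) : linear f -> linear (fun x => - f x).
  by move=> hf a u v; rewrite hf opprD scalerN.
apply: (linear_ext_e (bilin_ext_linearl _ y) (lN _ (bilin_ext_linearr _ y))).
move=> i hi.
apply: (linear_ext_e (bilin_ext_linearr _ _) (lN _ (bilin_ext_linearl _ _))).
by move=> j hj /=; rewrite -/(skew_ext h) !skew_ext_e // skew_table_skew.
Qed.

Lemma skew_extxx (h : nat -> nat -> V) x : skew_ext h x x = 0.
Proof.
have skewX (I : Type) (r : seq I) (G : I -> I -> V) :
    (forall i, G i i = 0) -> (forall i j, G i j = - G j i) ->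
    \sum_(i <- r) \sum_(j <- r) G i j = 0.
  move=> G0 GN; elim: r => [|i r IH]; first by rewrite big_nil.
  under eq_bigr do rewrite big_cons.
  rewrite big_cons big_split /= IH addr0 G0 add0r -big_split big1 //= => j _.
  by rewrite GN addNr.
rewrite /skew_ext /bilin_ext /lin_ext.
under eq_bigr do rewrite scaler_sumr.
apply: skewX => [i|i j].
  by rewrite /skew_table ltnn !scaler0.
by rewrite skew_table_skew !scalerN !scalerA mulrC.
Qed.

End BasisExtension.

Section M2.
Variable F : fieldType.
Notation e := (m2e F).

Definition m2_bracket : m2 F -> m2 F -> m2 F :=
  skew_ext (fun i j => if i == 1%N then e j.+1
                       else if i == 2 then e j.+2
                       else 0).

Lemma m2_jacobi x y z :
  m2_bracket x (m2_bracket y z) + m2_bracket y (m2_bracket z x)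
  + m2_bracket z (m2_bracket x y) = 0.
Proof.
have l0 : linear (fun _ : m2 F => 0 : m2 F).
  by move=> a u v; rewrite scaler0 addr0.
have lc (f g : m2 F -> m2 F) : linear f -> linear g -> linear (f \o g).
  by move=> hf hg a u v; rewrite /= hg hf.
have lD (f g h : m2 F -> m2 F) : linear f -> linear g -> linear h ->
    linear (fun u => f u + g u + h u).
  move=> hf hg hh a u v; rewrite hf hg hh !scalerDr.
  by rewrite (addrACA (a *: f u)) (addrACA (_ + a *: g u)).
have Bl v : linear (m2_bracket ^~ v) by exact: bilin_ext_linearl.
have Br v : linear (m2_bracket v) by exact: bilin_ext_linearr.
move: x; apply: linear_ext_e => //.
  apply: lD; [exact: Bl | exact: (lc _ _ (Br y) (Br z))
             | exact: (lc _ _ (Br z) (Bl y))].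
move=> a a0; move: y; apply: linear_ext_e => //.
  apply: lD; [exact: (lc _ _ (Br _) (Bl z)) | exact: Bl
             | exact: (lc _ _ (Br z) (Br _))].
move=> b b0; move: z; apply: linear_ext_e => //.
  apply: lD; [exact: (lc _ _ (Br _) (Br _)) | exact: (lc _ _ (Br _) (Bl _))
             | exact: Bl].
move=> c c0.
have B0 u : m2_bracket u 0 = 0.
  by have := Br u (-1) 0 0; rewrite !scaleN1r !addNr.
have BN u v : m2_bracket u (- v) = - m2_bracket u v.
  by have := Br u (-1) v 0; rewrite B0 !scaleN1r !addr0.
have BE i j : (1 <= i)%N -> (1 <= j)%N -> m2_bracket (e i) (e j) =
    skew_table (fun i j => if i == 1%N then e j.+1
                       else if i == 2 then e j.+2 else 0) i j.
  exact: skew_ext_e.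
have B1 i : m2_bracket (e 1) (e i.+2) = e i.+3 by rewrite BE.
have B2 i : m2_bracket (e 2) (e i.+3) = e i.+3.+2 by rewrite BE.
have B3 i j : m2_bracket (e i.+3) (e j.+3) = 0.
  by rewrite BE // /skew_table /= oppr0 !if_same.
have BX i : m2_bracket (e i) (e i) = 0 by apply: skew_extxx.
have B1' i : m2_bracket (e i.+2) (e 1) = - e i.+3.
  by rewrite -B1; apply: skew_ext_skew.
have B2' i : m2_bracket (e i.+3) (e 2) = - e i.+3.+2.
  by rewrite -B2; apply: skew_ext_skew.
have BB := (BX, B1, B2, B3, B1', B2', B0, BN).
case: a a0 => [//|[|[|a]]] _; case: b b0 => [//|[|[|b]]] _;
  case: c c0 => [//|[|[|c]]] _;
  by rewrite !BB ?oppr0 ?opprK ?addr0 ?add0r ?addNr ?subrr.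
Qed.

HB.instance Definition _ := @isLie.Build F (m2 F) m2_bracket
  (bilin_ext_linearl _) (bilin_ext_linearr _) (skew_extxx _) m2_jacobi.

Lemma m2_lie1 i : (2 <= i)%N -> lie (e 1) (e i) = e i.+1.
Proof. by move=> hi; rewrite -[lie _ _]/(m2_bracket _ _) /m2_bracket skew_ext_e ?(ltnW hi) // /skew_table hi. Qed.

Lemma m2_lie2 j : (3 <= j)%N -> lie (e 2) (e j) = e j.+2.
Proof.
by move=> hj; rewrite -[lie _ _]/(m2_bracket _ _) /m2_bracket skew_ext_e ?(ltnW (ltnW hj)) // /skew_table hj.
Qed.

Lemma m2_lie3 i j : (3 <= i)%N -> (3 <= j)%N -> lie (e i) (e j) = 0.
Proof.
case: i => [|[|[|i]]] //; case: j => [|[|[|j]]] // _ _.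
by rewrite -[lie _ _]/(m2_bracket _ _) /m2_bracket skew_ext_e // /skew_table /= oppr0 !if_same.
Qed.

Definition m2_deg (i : int) : set (m2 F) :=
  if i is Posz n then line (e n) else [set 0].

(* e^{i,j}_l; meaningful for 1 <= i < j *)
Definition m2_elem (i j l : nat) : m2 F -> m2 F -> m2 F :=
  skew_ext (fun a b => if (a == i) && (b == j) then e l else 0).

(* The sum over i >= 2 of e^{1,i}_{k+i+1} plus the sum over i >= 3 of
   e^{2,i}_{k+i+2}; see [m2_genE]. *)
Definition m2_gen (k : nat) : m2 F -> m2 F -> m2 F :=
  skew_ext (fun i j => if i == 1%N then e (k + j + 1)
                       else if i == 2 then e (k + j + 2)
                       else 0).

(* On a given pair of basis vectors, the partial sums are eventually constant,
   with value given by [m2_gen]. *)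
Lemma m2_genE k a b N : (1 <= a < N)%N -> (1 <= b < N)%N ->
  m2_gen k (e a) (e b) =
    \sum_(2 <= i < N) m2_elem 1 i (k + i + 1) (e a) (e b)
  + \sum_(3 <= i < N) m2_elem 2 i (k + i + 2) (e a) (e b).
Proof.
move=> /andP[a0 aN] /andP[b0 bN].
have E i0 m (g : nat -> nat) :
    \sum_(m <= i < N) m2_elem i0 i (g i) (e a) (e b) =
    skew_table (fun a b => if (a == i0) && (m <= b)%N then e (g b) else 0) a b.
  have S (c : bool) n : (n < N)%N ->
      \sum_(m <= i < N) (if c && (n == i) then e (g i) else 0)
      = if c && (m <= n)%N then e (g n) else 0.
    move=> nN; case: c => /=; last by rewrite big1.
    case: leqP => mn; last first.
      rewrite big_nat_cond big1 // => i; rewrite andbT => /andP[mi _].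
      by rewrite ltn_eqF // (leq_trans mn).
    rewrite (@bigD1_seq _ _ _ _ _ n) ?mem_index_iota ?mn ?iota_uniq //= eqxx.
    by rewrite big1 ?addr0 // => i /negbTE; rewrite eq_sym => ->.
  under eq_bigr do rewrite /m2_elem skew_ext_e // /skew_table.
  by rewrite /skew_table; case: ltngtP => ab; rewrite ?sumrN ?S // big1.
rewrite !E /m2_gen skew_ext_e // /skew_table; case: ltngtP => ab //=.
- case: a ab {E aN a0} => [|[|[|a]]] //= ab; rewrite ?ab ?addr0 ?add0r //.
- case: b ab {E bN b0} => [|[|[|b]]] //= ab; rewrite ?ab ?oppr0 ?addr0 ?add0r //.
- by rewrite addr0.
Qed.

Lemma m2_gen1 k i : (2 <= i)%N -> m2_gen k (e 1) (e i) = e (k + i + 1).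
Proof. by move=> hi; rewrite /m2_gen skew_ext_e ?(ltnW hi) // /skew_table hi. Qed.

Lemma m2_gen2 k i : (3 <= i)%N -> m2_gen k (e 2) (e i) = e (k + i + 2).
Proof.
move=> hi.
by rewrite /m2_gen skew_ext_e ?(ltnW (ltnW hi)) // /skew_table hi.
Qed.

Lemma m2_gen3 k i j : (3 <= i)%N -> (3 <= j)%N -> m2_gen k (e i) (e j) = 0.
Proof.
case: i => [|[|[|i]]] //; case: j => [|[|[|j]]] // _ _.
by rewrite /m2_gen skew_ext_e // /skew_table /= oppr0 !if_same.
Qed.

Lemma m2_gen_skew_bilinear k : skew_bilinear (m2_gen k).
Proof.
split; [exact: bilin_ext_linearl | exact: bilin_ext_linearr |].
exact: skew_ext_skew.
Qed.

End M2.

Arguments m2_deg : clear implicits.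
Arguments m2_gen : clear implicits.

(* Main.v *)
(* A biderivation of m_2 is determined by f(e_1, e_2), because e_1 and e_2
   generate m_2 and f(e_1, e_1) = f(e_2, e_2) = 0.  For k >= 0, let S be the
   shift e_i |-> e_(k+i); the generator is (x, y) |-> S [x, y], which is a
   biderivation because S commutes with every ad x on the derived algebra.  For
   k = -1 and k = -2, the relation [e_1, [e_1, [e_1, e_2]]] = [e_2, [e_1, e_2]]
   forces f(e_1, e_2) = 0, and for k <= -3 degree reasons do. *)
Require Import Defs.
From HB Require Import structures.
From mathcomp Require Import all_boot all_order all_algebra.
From mathcomp Require Import boolp classical_sets functions.
From mathcomp Require Import zify.

Set Implicit Arguments.
Unset Strict Implicit.
Unset Printing Implicit Defensive.
Import GRing.Theory.
Local Open Scope ring_scope.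

HB.instance Definition _ (F : fieldType) (L : lieAlgType F) (x : L) :=
  GRing.isLinear.Build F L L *:%R (lie x) (lie_linearr x).

Lemma linear_scale (F : fieldType) (V W : lmodType F) (f : V -> W) :
  linear f -> forall a x, f (a *: x) = a *: f x.
Proof.
move=> fl a x; have f0 : f 0 = 0.
  by have := fl (-1) 0 0; rewrite !scaleN1r !addNr.
by have := fl a x 0; rewrite f0 !addr0.
Qed.

Lemma lineP (F : fieldType) (V : lmodType F) (v w : V) :
  line v w <-> exists a, w = a *: v.
Proof.
split=> [[c ->]|[a ->]]; first by exists (c ord0); rewrite big_ord1.
by exists (fun=> a); rewrite big_ord1.
Qed.

(** * Biderivations of an arbitrary Lie algebra *)

Section LieAlgebraTheory.
Variables (F : fieldType) (L : lieAlgType F).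
Implicit Types (x y z : L) (f : L -> L -> L).

Lemma lieC x y : lie x y = - lie y x.
Proof.
have lD u v w : lie (u + v) w = lie u w + lie v w.
  by have := lie_linearl w 1 u v; rewrite !scale1r.
apply/eqP; rewrite -addr_eq0; apply/eqP.
by have := liexx (x + y); rewrite lD !linearD /= !liexx addr0 add0r.
Qed.

Lemma lie_leibniz x y z : lie x (lie y z) = lie (lie x y) z + lie y (lie x z).
Proof.
have /eqP := jacobi x y z; rewrite -addrA addr_eq0 => /eqP ->.
by rewrite opprD addrC (lieC z x) linearN /= opprK -lieC.
Qed.

(** Skew-symmetry carries the Leibniz rule from the second slot to the first. *)
Lemma skew_derivation_BDer f :
  skew_bilinear f -> (forall x, derivation (f x)) -> BDer f.
Proof.
move=> fs fD; split=> // x; split=> //; case: fs => fl _ fN.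
split=> [|y z] //; have [_ fxD] := fD x.
rewrite fN fxD (lieC (f x y)) opprD opprK (fN x y) (fN x z) !linearN /= opprK.
by rewrite (lieC z) opprK.
Qed.

(** Skew-symmetry gives 2 f(x, x) = 0, and 2 is invertible in characteristic zero. *)
Lemma BDerxx f x : [pchar F] =i pred0 -> BDer f -> f x x = 0.
Proof.
move=> F0 [[_ _ fN] _]; have /eqP := fN x x.
rewrite -addr_eq0 -mulr2n -scaler_nat scaler_eq0 => /orP[|/eqP//].
by rewrite (pcharf0P _).1.
Qed.

End LieAlgebraTheory.

(** * The shift of m_2 and the biderivations built from it *)

Section M2.
Variable F : fieldType.
Notation e := (m2e F).
Local Arguments m2e : simpl never.

Lemma m2e_eq0 i : (e i.+1 == 0) = false.
Proof. by apply/negbTE; apply: monic_neq0; apply: monicXn. Qed.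

(** The last clause covers [e_1, e_1] = 0: brackets only involve e_m with m >= 3, the range in which
    [lie_shift_e] applies. *)
Lemma m2_lie_e i j : (1 <= i)%N -> (1 <= j)%N ->
  exists a : F, lie (e i) (e j) = a *: e (i + j) /\ ((i + j <= 2)%N -> a = 0).
Proof.
move=> i0 j0; have [->|ij] := eqVneq i j.
  by exists 0; rewrite liexx scale0r.
wlog lij : i j i0 j0 ij / (i < j)%N => [H|].
  have [|lji|eij] := ltngtP i j; first exact: H.
    have [|a [E a0]] := H j i j0 i0 _ lji; first by rewrite eq_sym.
    exists (- a); rewrite lieC E scaleNr addnC; split=> // h.
    by rewrite a0 ?oppr0 // addnC.
  by rewrite eij eqxx in ij.
case: i i0 ij lij => [//|[|[|i]]] _ _ lij.
- by exists 1; rewrite m2_lie1 // scale1r add1n; split=> //; lia.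
- by exists 1; rewrite m2_lie2 // scale1r add2n; split=> //; lia.
- by exists 0; rewrite m2_lie3 ?scale0r //; lia.
Qed.

(** Since e_i is 'X^(i - 1), multiplication by 'X^n is the shift e_i |-> e_(n+i). *)
Definition m2_shift (n : nat) (x : m2 F) : m2 F :=
  ('X^n : {poly F}) * (x : {poly F}).

Lemma m2_shift_linear n : linear (m2_shift n).
Proof.
by move=> a x y; rewrite /m2_shift [LHS]mulrDr -[in LHS]scalerAr.
Qed.

HB.instance Definition _ n :=
  GRing.isLinear.Build F (m2 F) (m2 F) *:%R (m2_shift n) (m2_shift_linear n).

Lemma m2_shift_e n i : (1 <= i)%N -> m2_shift n (e i) = e (n + i).
Proof. by case: i => // i _; rewrite addnS /m2_shift /m2e -exprD. Qed.

(** For m >= 3, ad e_i sends e_m to e_(m+1), e_(m+2) or 0 by a rule independent of m. This breaks at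
    m = 2: [e_2, e_2] = 0, while [e_2, e_(n+2)] is nonzero for n > 0. *)
Lemma lie_shift_e n i m : (1 <= i)%N -> (3 <= m)%N ->
  lie (e i) (m2_shift n (e m)) = m2_shift n (lie (e i) (e m)).
Proof.
move=> i0 m3; rewrite m2_shift_e; last lia.
case: i i0 => [//|[|[|i]]] _.
- by rewrite !m2_lie1 ?m2_shift_e ?addnS //; lia.
- by rewrite !m2_lie2 ?m2_shift_e ?addnS //; lia.
- by rewrite !m2_lie3 ?linear0 //; lia.
Qed.

Lemma lie_shift n (x y z : m2 F) :
  lie x (m2_shift n (lie y z)) = m2_shift n (lie x (lie y z)).
Proof.
move: x; apply: linear_ext_e => [|a u v|i i0]; first exact: lie_linearl.
  by rewrite lie_linearl linearP.
move: y; apply: linear_ext_e => [a u v|a u v|j j0];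
  try by rewrite lie_linearl !linearP.
move: z; apply: linear_ext_e => [a u v|a u v|l l0]; try by rewrite !linearP.
have [a [-> a0]] := m2_lie_e j0 l0; rewrite !linearZ /=.
have [/a0 ->|jl] := leqP (j + l) 2; first by rewrite !scale0r.
by rewrite lie_shift_e.
Qed.

(** Replaces the table of values by a formula in the bracket, so that the Leibniz rule for the
    generator follows from the Jacobi identity. *)
Lemma m2_gen_shift n (x y : m2 F) : m2_gen F n x y = m2_shift n (lie x y).
Proof.
have [gl gr _] := m2_gen_skew_bilinear F n.
move: x; apply: linear_ext_e => // [a u v|i i0].
  by rewrite lie_linearl linearP.
move: y; apply: linear_ext_e => // [a u v|j j0]; first by rewrite !linearP.
have [->|ij] := eqVneq i j.
  by rewrite liexx linear0 /m2_gen skew_extxx.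
wlog lij : i j i0 j0 ij / (i < j)%N => [H|].
  have [|lji|eij] := ltngtP i j; first exact: H.
    rewrite lieC linearN /= -H ?(m2_gen_skew_bilinear F n) //; last first.
      by rewrite eq_sym.
    by have [_ _ ->] := m2_gen_skew_bilinear F n.
  by rewrite eij eqxx in ij.
case: i i0 ij lij => [//|[|[|i]]] _ _ lij.
- by rewrite m2_gen1 // m2_lie1 // m2_shift_e // addn1 addnS.
- by rewrite m2_gen2 // m2_lie2 // m2_shift_e // addn2 !addnS.
- by rewrite m2_gen3 ?m2_lie3 ?linear0 //; lia.
Qed.

(** Shift the Leibniz form of the Jacobi identity, then move the shift inside each outer bracket by
    [lie_shift]. The case c = 0 later supplies the zero biderivation. *)
Lemma scale_m2_gen_BDer n (c : F) : BDer (c *: m2_gen F n).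
Proof.
have E x y : (c *: m2_gen F n) x y = c *: m2_shift n (lie x y).
  by rewrite -m2_gen_shift.
apply: skew_derivation_BDer => [|x].
  split=> [y a u v|x a u v|x y]; rewrite !E ?lie_linearl ?linearP //=.
  by rewrite lieC !linearN.
split=> [a u v|y z].
- by rewrite !E !linearP.
- rewrite !E lie_leibniz !linearD linearZ /= lie_shift; congr (_ + _).
  by rewrite (lieC (c *: _)) linearZ /= lie_shift lieC !linearN.
Qed.

Lemma scale_m2_gen_deg n (c : F) :
  BDer_deg (m2_deg F) n%:Z (c *: m2_gen F n).
Proof.
split=> [|i j i0 j0 x y]; first exact: scale_m2_gen_BDer.
move=> /lineP[a ->] /lineP[b ->]; apply/lineP.
have [l [E _]] := m2_lie_e i0 j0; exists (a * b * c * l).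
rewrite -[LHS]/(c *: m2_gen F n _ _) m2_gen_shift.
rewrite (linear_scale (lie_linearl _)) !linearZ /= E [m2_shift _ _]linearZ /=
  m2_shift_e.
  by rewrite !scalerA addnA.
by rewrite addn_gt0 i0.
Qed.

(** Agreement propagates from e_2 upwards through e_(i+1) = [e_1, e_i]. *)
Lemma derivation_ext (D D' : m2 F -> m2 F) : derivation D -> derivation D' ->
  D (e 1) = D' (e 1) -> D (e 2) = D' (e 2) -> D =1 D'.
Proof.
move=> [Dl Dd] [Dl' Dd'] E1 E2; apply: linear_ext_e => // -[//|[//|i]] _.
elim: i => [//|i IH]; rewrite -m2_lie1 //.
by rewrite Dd Dd' E1 IH.
Qed.

(** * The graded components in characteristic zero *)

Section CharZero.
Hypothesis F0 : [pchar F] =i pred0.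

(** Three uses of [derivation_ext]: for f(e_1, -), for f(e_2, -), and then, by skew-symmetry, for
    f(x, -) with x arbitrary. *)
Lemma BDer_ext (f g : m2 F -> m2 F -> m2 F) : BDer f -> BDer g ->
  f (e 1) (e 2) = g (e 1) (e 2) -> f = g.
Proof.
move=> fB gB E; have [[_ _ fN] fD] := fB; have [[_ _ gN] gD] := gB.
have E1 : f (e 1) =1 g (e 1).
  by apply: derivation_ext => //; [case: (fD (e 1))|case: (gD (e 1))
    |rewrite !BDerxx].
have E2 : f (e 2) =1 g (e 2).
  by apply: derivation_ext; [case: (fD (e 2))|case: (gD (e 2))
    |rewrite fN gN E|rewrite !BDerxx].
apply/funext => x; apply/funext.
by apply: derivation_ext; [case: (fD x)|case: (gD x)
  |rewrite fN gN E1|rewrite fN gN E2].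
Qed.

Lemma BDer_deg_e12 k (f : m2 F -> m2 F -> m2 F) : BDer_deg (m2_deg F) k f ->
  m2_deg F (k + 3) (f (e 1) (e 2)).
Proof.
move=> [_ fd]; have := fd 1%N 2 isT isT (e 1) (e 2).
by rewrite -addrA; apply; apply/lineP; exists 1; rewrite scale1r.
Qed.

(** By degree f(e_1, e_2) = c e_(n+3), which is also the value of c times the generator at (e_1,
    e_2). *)
Lemma BDer_deg_nat n : BDer_deg (m2_deg F) n%:Z = line (m2_gen F n).
Proof.
apply/seteqP; split=> f; last by move=> /lineP[c ->]; apply: scale_m2_gen_deg.
move=> fk; have /lineP[c fE] := BDer_deg_e12 fk.
apply/lineP; exists c; apply: BDer_ext (scale_m2_gen_BDer n c) _.
  by case: fk.
by rewrite fE -[RHS]/(c *: m2_gen F n _ _) m2_gen1 // -addnA.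
Qed.

Lemma BDer_deg_neg k (f : m2 F -> m2 F -> m2 F) :
  k <= -1 -> BDer_deg (m2_deg F) k f -> f = 0.
Proof.
move=> k0 fk; have [fB _] := fk; have fE := BDer_deg_e12 fk.
have [_ /(_ (e 1))[[_ D] _]] := fB.
have f1 := BDerxx (e 1) F0 fB.
suff f2 : f (e 1) (e 2) = 0.
  have B0 : BDer (0 : m2 F -> m2 F -> m2 F).
    by rewrite -(scale0r (m2_gen F 0)); apply: scale_m2_gen_BDer.
  by apply: BDer_ext B0 _.
(* As f(e_1, e_1) = 0, the map f(e_1, -) commutes with ad e_1. *)
have step i : (2 <= i)%N -> f (e 1) (e i.+1) = lie (e 1) (f (e 1) (e i)).
  by move=> i2; rewrite -(m2_lie1 F i2) D f1 lieC linear0 oppr0 add0r.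
(* Since e_5 = [e_2, e_3] = [e_1, e_4], f(e_1, e_5) can be computed in two ways. *)
have f5 := D (e 2) (e 3); rewrite m2_lie2 // in f5.
have [kE|[kE|k3]] : k = -1 \/ k = -2 \/ k <= -3 by lia.
(* With f(e_1, e_2) = c e_2, the two computations give c e_5 = 2c e_5. *)
- rewrite kE in fE; have /lineP[c fc] : line (e 2) (f (e 1) (e 2)) := fE.
  have := f5; rewrite (step 4) // (step 3) // (step 2) // fc !linearZ /=
    !m2_lie1 // lieC linearZ /=.
  rewrite lieC scalerN opprK m2_lie2 // => /eqP.
  rewrite -subr_eq0 opprD addrA subrr add0r oppr_eq0 scaler_eq0 m2e_eq0 orbF.
  by move=> /eqP ->; rewrite scale0r.
(* With f(e_1, e_2) = c e_1, already f(e_1, e_3) = 0, and the two computations give 0 = c e_4. *)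
- rewrite kE in fE; have /lineP[c fc] : line (e 1) (f (e 1) (e 2)) := fE.
  have := f5; rewrite (step 4) // (step 3) // (step 2) // fc !linearZ /=
    liexx !linear0 addr0.
  rewrite lieC linearZ /= lieC scalerN opprK m2_lie1 // => /esym/eqP.
  by rewrite scaler_eq0 m2e_eq0 orbF => /eqP ->; rewrite scale0r.
(* For k = -3 the component is [line (e 0)], which is zero because [e 0] is the zero vector. *)
- move: fE; case kE: (k + 3) => [[|m]|m]; last by [].
    by move=> /lineP[c ->]; rewrite scaler0.
  by exfalso; lia.
Qed.

(** Evaluation at (e_1, e_2) gives c e_(n+3) = 0. *)
Lemma m2_gen_scale_eq0 n (c : F) : c *: m2_gen F n = 0 -> c = 0.
Proof.
move=> /(congr1 (fun f => f (e 1) (e 2))).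
rewrite -[LHS]/(c *: m2_gen F n _ _) -[RHS]/(0 : m2 F) m2_gen1 // addn1 => /eqP.
by rewrite scaler_eq0 m2e_eq0 orbF => /eqP.
Qed.

End CharZero.
End M2.

Theorem theorem4p1 (F : closedFieldType) (charF : [pchar F] =i pred0)
    (k : int) :
  [/\ 0 <= k -> has_dim (BDer_deg (m2_deg F) k) 1,
      k <= -1 -> has_dim (BDer_deg (m2_deg F) k) 0
    & forall n : nat, k = n%:Z ->
        BDer_deg (m2_deg F) k = line (m2_gen F n)].
Proof.
split=> [k0|k0|n ->]; last exact: BDer_deg_nat.
- case: k k0 => // n _; exists (fun=> m2_gen F n).
  split; last exact: BDer_deg_nat.
  move=> c; rewrite big_ord1 => /m2_gen_scale_eq0 c0 i.
  by rewrite ord1.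
(* The family is indexed by the empty type ['I_0]; it remains to see that the component is exactly
   the zero map. *)
- exists (fun=> 0); split=> [c _ []//|].
  apply/seteqP; split=> f => [fk|[c ->]].
    by exists (fun=> 0); rewrite big_ord0; apply: BDer_deg_neg fk.
  rewrite big_ord0; split.
    by rewrite -(scale0r (m2_gen F 0)); apply: scale_m2_gen_BDer.
  move=> i j _ _ x y _ _; rewrite -[(0 : m2 F -> _) x y]/(0 : m2 F).
  by case: (k + i%:Z + j%:Z) => [m|//]; apply/lineP; exists 0; rewrite scale0r.
Qed.
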